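(* In the identification game with a three-dimensional random variable ($d=3$, values $x_1,x_2,x_3$) and sets $S_1=\{x_1,x_2\}$, $S_2=\{x_2,x_3\}$, $S_3=\{x_3,x_1\}$ ($n=2$), there exists a strategy by which the game is won when Alice sends one qubit to Bob. That is, there exist unit vectors $|\phi_1\rangle,|\phi_2\rangle,|\phi_3\rangle\in\mathbb{C}^2$ and, for each $j\in\{1,2,3\}$, a POVM $\{E^{(j)}_i : x_i\in S_j\}\cup\{E^{(j)}_?\}$ on $\mathbb{C}^2$ such that for every $j$ and all $x_i,x_{i'}\in S_j$ with $i\neq i'$ one has $\langle\phi_{i'}|E^{(j)}_i|\phi_{i'}\rangle=0$ and $\langle\phi_i|E^{(j)}_i|\phi_i\rangle>0$.
   Context: The game: a Referee sends Alice a value $x_i$ of a random variable $X$ with values $\{x_1,x_2,x_3\}$ (equally probable) and simultaneously sends Bob an index $j\in\{1,2,3\}$ such that $x_i\in S_j$. Alice does not know $j$; Bob does not know $x_i$ (only that $x_i\in S_j$). The value set and the sets $S_j$ are known to both, and the encoding-decoding strategy is fixed before the game begins. Alice and Bob share no randomness or other correlations. With a qubit, Alice encodes $x_i\mapsto|\phi_i\rangle$, a pure state (unit vector) in $\mathbb{C}^2$, and sends it to Bob, who performs a measurement (POVM: positive semidefinite operators summing to the identity), which may depend on $j$; outcome $i$ means he answers $x_i$, and outcome $?$ is inconclusive. The game is won if and only if, for every $j$ and every $x_i\in S_j$, Bob identifies $x_i$ unambiguously, i.e. he never outputs a wrong value and outputs the right value with nonzero probability. *)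

(* Defs.v *)
From HB Require Import structures.
From mathcomp Require Import all_boot all_order all_algebra.
From mathcomp Require Import sesquilinear spectral.
From mathcomp Require Import complex.
From mathcomp Require Import reals.

Set Implicit Arguments.
Unset Strict Implicit.
Unset Printing Implicit Defensive.

Import Order.TTheory GRing.Theory Num.Theory.
Local Open Scope ring_scope.
Local Open Scope sesquilinear_scope.

(* <v|A|v>; on a unit vector and a POVM element this is the Born probability.
   In the order of a numClosedFieldType, 0 <= z and 0 < z entail that z is real. *)
Definition expval (C : numClosedFieldType) (n : nat)
    (A : 'M[C]_n) (v : 'cV[C]_n) : C :=
  (v ^t* *m A *m v) 0 0.

Definition unit_ket (C : numClosedFieldType) (n : nat) (v : 'cV[C]_n) : Prop :=
  (v ^t* *m v) 0 0 = 1.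

Definition psdmx (C : numClosedFieldType) (n : nat) (A : 'M[C]_n) : Prop :=
  A \is hermsymmx /\ forall v : 'cV[C]_n, 0 <= expval A v.

Definition povm (C : numClosedFieldType) (n : nat) (O : finType)
    (E : O -> 'M[C]_n) : Prop :=
  (forall o, psdmx (E o)) /\ \sum_o E o = 1%:M.

(* Values and sets are indexed from 0: x_(i+1) is i : 'I_3, and S_(j+1) is
   cyclic_pair j. As ordS is the cyclic successor, the three sets are
   {0, 1}, {1, 2}, {2, 0}. *)
Definition cyclic_pair (j : 'I_3) : {set 'I_3} := [set j; ordS j].

(* The values that the receiver of the index j may answer. *)
Definition answer (d m : nat) (S : 'I_m -> {set 'I_d}) (j : 'I_m) : finType :=
  {i : 'I_d | i \in S j}.

(* None is the inconclusive outcome "?". *)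
Definition outcome (d m : nat) (S : 'I_m -> {set 'I_d}) (j : 'I_m) : finType :=
  option (answer S j).

(* Main.v *)
(* Three pairwise non-parallel qubit states suffice, since Bob only has to tell
   apart two of them, phi and psi, and the projectors onto their orthogonal
   complements do so without error: 1 - |psi><psi| vanishes on psi and has value
   1 - |<psi|phi>|^2 > 0 on phi. The states chosen are (1, 0), (3/5, 4/5) and
   (0, 1). *)
Require Import Defs.
From HB Require Import structures.
From mathcomp Require Import all_boot all_order all_algebra.
From mathcomp Require Import sesquilinear spectral.
From mathcomp Require Import complex.
From mathcomp Require Import reals.
From mathcomp Require Import ring.

Set Implicit Arguments.
Unset Strict Implicit.
Unset Printing Implicit Defensive.

Import Order.TTheory GRing.Theory Num.Theory.
Local Open Scope ring_scope.

Local Open Scope sesquilinear_scope.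

(** The expectation at [v] is the squared norm of [B *m v], a sum of squared moduli. *)
Lemma psdmx_gram (C : numClosedFieldType) (m n : nat) (B : 'M[C]_(m, n)) :
  psdmx (B ^t* *m B).
Proof.
split.
  by apply/is_hermitianmxP; rewrite expr0 scale1r trmx_mul map_mxM trmxCK.
move=> v; rewrite /expval mulmxA -mulmxA -map_mxM -trmx_mul mxE.
apply: sumr_ge0 => k _.
by rewrite !mxE mulrC mul_conjC_ge0.
Qed.

Lemma expvalD (C : numClosedFieldType) (n : nat) (A B : 'M[C]_n) (v : 'cV[C]_n) :
  expval (A + B) v = expval A v + expval B v.
Proof. by rewrite /expval mulmxDr mulmxDl mxE. Qed.

Lemma expvalZ (C : numClosedFieldType) (n : nat) (a : C) (A : 'M[C]_n)
    (v : 'cV[C]_n) :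
  expval (a *: A) v = a * expval A v.
Proof. by rewrite /expval -scalemxAr -scalemxAl mxE. Qed.

Lemma psdmxD (C : numClosedFieldType) (n : nat) (A B : 'M[C]_n) :
  psdmx A -> psdmx B -> psdmx (A + B).
Proof.
move=> [/is_hermitianmxP + A0] [/is_hermitianmxP + B0].
rewrite expr0 !scale1r => hA hB; split.
  by apply/is_hermitianmxP; rewrite expr0 scale1r linearD map_mxD -hA -hB.
by move=> v; rewrite expvalD addr_ge0.
Qed.

Lemma psdmxZ (C : numClosedFieldType) (n : nat) (a : C) (A : 'M[C]_n) :
  0 <= a -> psdmx A -> psdmx (a *: A).
Proof.
move=> a0 [/is_hermitianmxP + A0]; rewrite expr0 scale1r => hA; split.
  apply/is_hermitianmxP.
  by rewrite expr0 scale1r linearZ map_mxZ /= -hA conj_Creal ?ger0_real.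
by move=> v; rewrite expvalZ mulr_ge0.
Qed.

Definition ketbra (C : numClosedFieldType) (n : nat) (v : 'cV[C]_n) : 'M[C]_n :=
  v *m v ^t*.

Definition braket (C : numClosedFieldType) (n : nat) (u v : 'cV[C]_n) : C :=
  (u ^t* *m v) 0 0.

Lemma psdmx_ketbra (C : numClosedFieldType) (n : nat) (v : 'cV[C]_n) :
  psdmx (ketbra v).
Proof. by have := psdmx_gram (v ^t*); rewrite trmxCK. Qed.

(** For a unit vector the matrix is an orthogonal projector: being hermitian and idempotent, it is
    its own Gram matrix. *)
Lemma psdmx_compl_ketbra (C : numClosedFieldType) (n : nat) (v : 'cV[C]_n) :
  unit_ket v -> psdmx (1%:M - ketbra v).
Proof.
move=> v1; have vv : v ^t* *m v = 1%:M by rewrite [LHS]mx11_scalar v1.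
suff -> : 1%:M - ketbra v = (1%:M - ketbra v) ^t* *m (1%:M - ketbra v).
  exact: psdmx_gram.
rewrite [(_ - _)^T]linearB /= map_mxB trmx1 map_mx1 /ketbra trmx_mul map_mxM trmxCK.
rewrite mulmxBl mul1mx mulmxBr mulmx1 mulmxA -(mulmxA v) vv mulmx1.
by rewrite subrr subr0.
Qed.

Lemma expval_compl_ketbra (C : numClosedFieldType) (n : nat) (u v : 'cV[C]_n) :
  unit_ket u -> expval (1%:M - ketbra v) u = 1 - `|braket v u| ^+ 2.
Proof.
move=> u1; rewrite /expval mulmxBr mulmxBl mulmx1 mxE [X in _ + X]mxE u1.
(* The subtracted term factors as <u|v><v|u>, and <u|v> is the conjugate of <v|u>. *)
congr (_ - _); rewrite /ketbra mulmxA -mulmxA mxE big_ord1 normCKC.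
by rewrite /braket -[v in LHS]trmxCK -map_mxM -trmx_mul trmxCK !mxE.
Qed.

(** This trades the dependent outcome type for a plain sum over a set, which can then be split
    element by element. *)
Lemma sum_outcome (V : nmodType) (d m : nat) (S : 'I_m -> {set 'I_d})
    (j : 'I_m) (F : outcome S j -> V) (G : 'I_d -> V) :
  (forall i : answer S j, F (Some i) = G (val i)) ->
  \sum_o F o = F None + \sum_(i in S j) G i.
Proof.
move=> FG; rewrite (bigD1 None) //=; congr (_ + _).
rewrite (reindex_omap Some id) /=; last by case.
rewrite [RHS]big_sub.
by apply: eq_big => [i|i _]; rewrite ?eqxx ?FG.
Qed.

(** The other element of the pair of index [j]; for [i] outside that pair the value [j] is a mere
    default. *)
Definition partner (j i : 'I_3) : 'I_3 := if i == j then ordS j else j.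

Lemma ordS3_neq (j : 'I_3) : ordS j != j.
Proof. by case: j => [[|[|[|]]]]. Qed.

Lemma partner_neq (j i i' : 'I_3) :
  i \in cyclic_pair j -> i' \in cyclic_pair j -> i != i' -> partner j i = i'.
Proof.
rewrite /partner !inE => /orP[]/eqP-> /orP[]/eqP->; rewrite ?eqxx //.
by rewrite (negbTE (ordS3_neq j)).
Qed.

(* The factor 1/2 makes the inconclusive element, the complement of the other
   two, a nonnegative combination of projectors. *)
Definition discriminator (C : numClosedFieldType) (n : nat)
    (phi : 'I_3 -> 'cV[C]_n) (j : 'I_3) (o : outcome cyclic_pair j) : 'M[C]_n :=
  2^-1 *: (if o is Some i then 1%:M - ketbra (phi (partner j (val i)))
           else ketbra (phi j) + ketbra (phi (ordS j))).

Lemma povm_discriminator (C : numClosedFieldType) (n : nat)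
    (phi : 'I_3 -> 'cV[C]_n) (j : 'I_3) :
  (forall i, unit_ket (phi i)) -> povm (discriminator phi (j := j)).
Proof.
move=> phi1; split=> [o|].
  apply: psdmxZ; first by rewrite invr_ge0 ler0n.
  case: o => [i|]; first exact: psdmx_compl_ketbra.
  by apply: psdmxD; apply: psdmx_ketbra.
pose G i := 2^-1 *: (1%:M - ketbra (phi (partner j i))).
rewrite (sum_outcome (G := G)) // /G.
rewrite big_setU1 ?big_set1 ?inE 1?eq_sym ?ordS3_neq //=.
rewrite /partner eqxx (negbTE (ordS3_neq j)) -!scalerDr.
(* Each of the two projectors is matched with its own complement, so the bracket is twice the
   identity, which the factor 1/2 normalizes. *)
rewrite [X in _ + X]addrC addrACA !(addrC (ketbra _)) !subrK.
by rewrite -mulr2n -scaler_nat scalerA mulVf ?pnatr_eq0 ?scale1r.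
Qed.

Lemma discriminator_unambiguous (C : numClosedFieldType) (n : nat)
    (phi : 'I_3 -> 'cV[C]_n) (j : 'I_3) (i i' : answer cyclic_pair j) :
  (forall k, unit_ket (phi k)) ->
  (forall k l, k != l -> `|braket (phi k) (phi l)| < 1) -> i != i' ->
  expval (discriminator phi (Some i)) (phi (val i')) = 0 /\
  0 < expval (discriminator phi (Some i)) (phi (val i)).
Proof.
move=> phi1 phi_lt1 ii'; rewrite /discriminator.
(* A pair has only two elements, so [i'] is the partner of [i] and the element for [i] projects off
   the state of [i']. *)
rewrite (partner_neq (valP i) (valP i') ii') !expvalZ !expval_compl_ketbra //.
split; first by rewrite /braket phi1 normr1 expr1n subrr mulr0.
rewrite mulr_gt0 ?invr_gt0 ?ltr0n // subr_gt0 expr_lt1 // phi_lt1 //.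
by rewrite eq_sym.
Qed.

(** The triple 3, 4, 5 gives a unit vector with rational coordinates, so no square root occurs. The
    default (0, 0) is never reached. *)
Definition phi_coord (C : numClosedFieldType) (i : 'I_3) : C * C :=
  nth (0, 0) [:: (1, 0); (3 / 5, 4 / 5); (0, 1)] i.

Definition phi345 (C : numClosedFieldType) (i : 'I_3) : 'cV[C]_2 :=
  \col_k (if k == 0 then (phi_coord C i).1 else (phi_coord C i).2).

Lemma braket_phi345 (C : numClosedFieldType) (i j : 'I_3) :
  braket (phi345 C i) (phi345 C j) =
  (phi_coord C i).1 * (phi_coord C j).1 + (phi_coord C i).2 * (phi_coord C j).2.
Proof.
rewrite /braket mxE big_ord_recl big_ord1 !mxE /=; congr (_ * _ + _ * _);
case: i => [[|[|[|]]]] //= _; rewrite ?conjC0 ?conjC1 //;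
by rewrite conj_Creal // ger0_real // divr_ge0 // ler0n.
Qed.

Lemma phi345_unit (C : numClosedFieldType) (i : 'I_3) : unit_ket (phi345 C i).
Proof.
rewrite /unit_ket -/(braket _ _) braket_phi345.
by case: i => [[|[|[|]]]] //= _; rewrite ?mul0r ?mulr1 ?addr0 ?add0r //; field.
Qed.

Lemma phi345_lt1 (C : numClosedFieldType) (i j : 'I_3) :
  i != j -> `|braket (phi345 C i) (phi345 C j)| < 1.
Proof.
rewrite braket_phi345.
(* The overlaps of distinct states are 3/5, 4/5 and 0; this bound serves the first two. *)
have lt5 k : (k < 5)%N -> k%:R / 5 < 1 :> C.
  by move=> k5; rewrite ltr_pdivrMr ?ltr0n // mul1r ltr_nat.
case: i j => [[|[|[|]]]] //= ? [[|[|[|]]]] //= ? _;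
rewrite ?(mul0r, mulr0, mul1r, mulr1, addr0, add0r, normr0) //;
by rewrite ger0_norm ?lt5 // divr_ge0 // ler0n.
Qed.

Theorem proposition2 (R : realType) :
  exists (phi : 'I_3 -> 'cV[R[i]]_2)
         (E : forall j : 'I_3, outcome cyclic_pair j -> 'M[R[i]]_2),
    [/\ forall i : 'I_3, unit_ket (phi i),
        forall j : 'I_3, povm (E j)
      & forall (j : 'I_3) (i i' : answer cyclic_pair j), i != i' ->
          expval (E j (Some i)) (phi (val i')) = 0 /\
          0 < expval (E j (Some i)) (phi (val i))].
Proof.
exists (phi345 R[i]), (discriminator (phi345 R[i])).
have phi1 := @phi345_unit R[i].
split=> // [j|j i i' ii']; first exact: povm_discriminator.
exact: (discriminator_unambiguous phi1 (@phi345_lt1 R[i]) ii').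
Qed.
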